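(* For every $\Sigma_+^*\in(-1,-1/4)$, every real $\lambda^*$ with $(\lambda^* )^2>1$, and every $\gamma\in(0,2)$, there exists one, and only one up to winding number, closed periodic orbit with $V=1$ of the reduced tilt system with these parameters (see context).
   Context: Reduced tilt system. The variables are $x=v_1$, $\rho=v_2^2+v_3^2$ and the angle $\theta$ (mod $2\pi$) defined for $\rho>0$ by $2v_2v_3=\rho\sin\theta$, $v_2^2-v_3^2=\rho\cos\theta$, where $(v_1,v_2,v_3)\in\mathbb{R}^3$ is the tilt velocity, considered up to the symmetry $(v_2,v_3)\mapsto(-v_2,-v_3)$. The state space is $\rho\ge 0$, $V^2:=x^2+\rho\le 1$ (with $V\ge 0$); at $\rho=0$ the angle $\theta$ has no meaning (all points with $\rho=0$ and the same $x$ are identified), so that the invariant set $V=1$ is topologically a sphere $S^2$ with poles $x=\pm1$. The parameters $\gamma,\Sigma_+^*,\lambda^*$ and $A^*=1+\Sigma_+^*$, $N^*=\sqrt{-\Sigma_+^*(1+\Sigma_+^* )}$ are constants. The system is (prime $=d/d\tau$) $$x'=(T+2\Sigma_+^* )x-(A^*+\sqrt3N^*\cos\theta)\rho,$$ $$\rho'=2\left(T-\Sigma_+^*+A^*x-\alpha\cos\theta\right)\rho,$$ $$\theta'=2\alpha(\lambda^*+\sin\theta),$$ where $\alpha=\sqrt3(1-x)N^*$, $$T=\frac{\left[(3\gamma-4)-2(\gamma-1)A^*x\right](1-V^2)+(2-\gamma)V^2\mathcal{S}}{1-(\gamma-1)V^2},\qquad V^2\mathcal{S}=-2\Sigma_+^*x^2+\Sigma_+^*\rho+\sqrt3N^*\rho\cos\theta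 .$$ ''Closed periodic orbit'' means a periodic orbit which is not an equilibrium point. ''Only one up to winding number'' means that any two such orbits trace out the same closed curve, differing at most in how many times the curve is traversed. *)

(* Defs.v *)
From Stdlib Require Import Reals.
From Coquelicot Require Import Coquelicot.
Open Scope R_scope.

(* In terms of the tilt velocity (v1,v2,v3) modulo (v2,v3) -> (-v2,-v3):
   x = v1, rho = v2^2 + v3^2, rho cos theta = v2^2 - v3^2 and
   rho sin theta = 2 v2 v3.  The angle is represented by a real number;
   [same_state] identifies the representatives of one point of the state
   space: theta is taken mod 2 pi, and has no meaning where rho = 0. *)
Record state : Type := State { x : R; rho : R; theta : R }.

Definition same_state (p q : state) : Prop :=
  x p = x q /\ rho p = rho q /\
  (rho p = 0 \/ exists k : Z, theta p = theta q + 2 * PI * IZR k).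

Definition V (p : state) : R := sqrt ((x p)^2 + rho p).

Definition in_state_space (p : state) : Prop := 0 <= rho p /\ V p <= 1.

Definition Astar (Sigma : R) : R := 1 + Sigma.

Definition Nstar (Sigma : R) : R := sqrt (- Sigma * (1 + Sigma)).

Definition alpha (Sigma : R) (p : state) : R :=
  sqrt 3 * (1 - x p) * Nstar Sigma.

(* The product V^2 S of the equations; S itself is undefined at V = 0. *)
Definition V2S (Sigma : R) (p : state) : R :=
  - 2 * Sigma * (x p)^2 + Sigma * rho p
  + sqrt 3 * Nstar Sigma * rho p * cos (theta p).

(* The denominator is positive on the state space when 0 < gamma < 2. *)
Definition T (gamma Sigma : R) (p : state) : R :=
  (((3 * gamma - 4) - 2 * (gamma - 1) * Astar Sigma * x p) * (1 - (V p)^2)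
   + (2 - gamma) * V2S Sigma p)
  / (1 - (gamma - 1) * (V p)^2).

Definition x_rhs (gamma Sigma : R) (p : state) : R :=
  (T gamma Sigma p + 2 * Sigma) * x p
  - (Astar Sigma + sqrt 3 * Nstar Sigma * cos (theta p)) * rho p.

Definition rho_rhs (gamma Sigma : R) (p : state) : R :=
  2 * (T gamma Sigma p - Sigma + Astar Sigma * x p
       - alpha Sigma p * cos (theta p)) * rho p.

Definition theta_rhs (Sigma lambda : R) (p : state) : R :=
  2 * alpha Sigma p * (lambda + sin (theta p)).

(* A solution for all times, with the angle lifted from the circle to R.
   The right-hand sides for x and rho do not depend on theta where rho = 0,
   so no condition on the meaningless angle is imposed there. *)
Definition is_solution (gamma Sigma lambda : R) (c : R -> state) : Prop :=
  forall t : R,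
    in_state_space (c t) /\
    is_derive (fun s => x (c s)) t (x_rhs gamma Sigma (c t)) /\
    is_derive (fun s => rho (c s)) t (rho_rhs gamma Sigma (c t)) /\
    (0 < rho (c t) ->
     is_derive (fun s => theta (c s)) t (theta_rhs Sigma lambda (c t))).

(* [P] is some period of the orbit, not necessarily the least one: the pair
   (c, P) stands for the closed path c on [0, P], which may run several times
   through the same closed curve. *)
Definition closed_periodic_orbit (gamma Sigma lambda : R)
    (c : R -> state) (P : R) : Prop :=
  is_solution gamma Sigma lambda c /\
  0 < P /\
  (forall t : R, same_state (c (t + P)) (c t)) /\
  ~ (forall t : R, same_state (c t) (c 0)).

Definition closed_periodic_orbit_V1 (gamma Sigma lambda : R)
    (c : R -> state) (P : R) : Prop :=
  closed_periodic_orbit gamma Sigma lambda c P /\ (forall t : R, V (c t) = 1).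

Definition on_trace (c : R -> state) (P : R) (p : state) : Prop :=
  exists t : R, 0 <= t <= P /\ same_state p (c t).

Definition same_trace (c1 : R -> state) (P1 : R)
    (c2 : R -> state) (P2 : R) : Prop :=
  forall p : state, on_trace c1 P1 p <-> on_trace c2 P2 p.

(* (c, P) is, up to the choice of the starting point, the closed path
   (c0, P0) traversed n times. *)
Definition traversed (c0 : R -> state) (P0 : R) (n : nat)
    (c : R -> state) (P : R) : Prop :=
  (0 < n)%nat /\ P = INR n * P0 /\
  exists s : R, forall t : R, same_state (c t) (c0 (t + s)).

Definition same_up_to_winding_number (gamma Sigma lambda : R)
    (c1 : R -> state) (P1 : R) (c2 : R -> state) (P2 : R) : Prop :=
  same_trace c1 P1 c2 P2 /\
  exists (c0 : R -> state) (P0 : R),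
    closed_periodic_orbit_V1 gamma Sigma lambda c0 P0 /\
    (exists n : nat, traversed c0 P0 n c1 P1) /\
    (exists n : nat, traversed c0 P0 n c2 P2).

(* Main.v *)
(* On V = 1 a closed orbit avoids the poles, and theta is strictly monotone
   because |lambda| > 1.  In the coordinate w = (1 - x) / (2 (1 + x)) the system
   becomes w' = (1 - x) ((k cos theta - m) w + b) and
   theta' = (1 - x) k (lambda + sin theta), with k = 2 sqrt 3 N*,
   m = - (1 + 4 Sigma) > 0 and b = 1/2 - Sigma > 0, so w as a function of theta
   solves a linear equation.  It has a positive solution which is a
   trigonometric polynomial of degree one.  The distance of w to it, divided by
   lambda + sin theta, decays at rate m (1 - x), hence is zero on a closed
   orbit.  On the curve so obtained theta solves an autonomous scalar equation
   with nonvanishing right-hand side, whose solutions are time shifts of one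
   another. *)

Require Import Defs.
From Stdlib Require Import ZArith Reals Lra Lia.
From Coquelicot Require Import Coquelicot.
Open Scope R_scope.

(** * Calculus of one real variable: global inverses and a Gronwall argument *)

Lemma derive_zero_const (f : R -> R) :
  (forall t, is_derive f t 0) -> forall a b, f a = f b.
Proof.
  intros H a b.
  destruct (Rtotal_order a b) as [Hab | [-> | Hab]]; [ | reflexivity | symmetry];
    apply (eq_is_derive f _ _ (fun t _ => H t) Hab).
Qed.

Lemma derive_ge_increment (f g : R -> R) (e : R) :
  (forall t, is_derive f t (g t)) -> (forall t, e <= g t) ->
  forall a b, a <= b -> e * (b - a) <= f b - f a.
Proof.
  intros Hf Hg a b [Hab | ->]; [ | lra].
  destruct (MVT_cor2 f g a b Hab) as [c [Hc _]].
  { intros c _; apply is_derive_Reals, Hf. }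
  rewrite Hc; apply Rmult_le_compat_r; [lra | apply Hg].
Qed.

(** Slope at least [e] makes [f] injective and, by the intermediate value theorem, onto the line.
    The derivative of the inverse comes straight from difference quotients:
    [/ q - / l = - (q - l) / (l * q)], where both [q] and [l] are at least [e]. *)
Lemma inverse_of_derive_ge (f g : R -> R) (e : R) :
  0 < e -> (forall t, is_derive f t (g t)) -> (forall t, e <= g t) ->
  exists h : R -> R,
    (forall t, f (h t) = t) /\ (forall y, h (f y) = y) /\
    (forall t, is_derive h t (/ g (h t))).
Proof.
  intros He Hf Hg.
  pose proof (derive_ge_increment f g e Hf Hg) as Hgrow.
  assert (Hcont : continuity f).
  { intros y; apply continuity_pt_filterlim.
    apply (ex_derive_continuous f y); exists (g y); apply Hf. }
  assert (Hinj : forall a b, f a = f b -> a = b).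
  { intros a b Hab.
    destruct (Rtotal_order a b) as [H | [H | H]]; [ | exact H | ].
    - pose proof (Hgrow a b ltac:(lra)); nra.
    - pose proof (Hgrow b a ltac:(lra)); nra. }
  assert (Hsurj : forall t, {y | f y = t}).
  { intros t.
    (* Moving a distance [r] from 0 changes [f] by at least [|t - f 0|] in each direction, so [t]
       lies between [f (- r)] and [f r]. *)
    set (r := Rabs (t - f 0) / e).
    assert (Hr : 0 <= r).
    { apply Rdiv_le_0_compat; [apply Rabs_pos | exact He]. }
    assert (Her : e * r = Rabs (t - f 0)) by (unfold r; field; lra).
    pose proof (Hgrow 0 r Hr) as H1.
    pose proof (Hgrow (- r) 0 ltac:(lra)) as H2.
    pose proof (Rle_abs (t - f 0)) as H3.
    pose proof (Rle_abs (- (t - f 0))) as H4. rewrite Rabs_Ropp in H4.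
    destruct (IVT_gen f (- r) r t Hcont) as [y [_ Hy]].
    - rewrite Rmin_left, Rmax_right; lra.
    - exists y; exact Hy. }
  exists (fun t => proj1_sig (Hsurj t)).
  assert (Hfh : forall t, f (proj1_sig (Hsurj t)) = t).
  { intros t; destruct (Hsurj t); assumption. }
  split; [exact Hfh | split].
  { intros y; apply Hinj, Hfh. }
  set (h := fun t => proj1_sig (Hsurj t)).
  change (forall t, f (h t) = t) in Hfh.
  change (forall t, is_derive h t (/ g (h t))).
  intros t; apply is_derive_Reals; intros eta Heta.
  set (l := g (h t)).
  assert (Hl : e <= l) by apply Hg.
  (* The factor [e * e] in the tolerance compensates for dividing by [l * (s / u)]. The radius
     [e * d] ensures [|u| < d], since [e * |u| <= |s|]. *)
  destruct (proj1 (is_derive_Reals _ _ _) (Hf (h t)) (eta * (e * e))) as [d Hd].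
  { apply Rmult_lt_0_compat; [ | apply Rmult_lt_0_compat]; lra. }
  assert (Hed : 0 < e * d) by (apply Rmult_lt_0_compat; [exact He | apply cond_pos]).
  exists (mkposreal _ Hed); simpl; intros s Hs Hsd.
  set (u := h (t + s) - h t).
  assert (Hfu : f (h t + u) - f (h t) = s).
  { unfold u; replace (h t + (h (t + s) - h t)) with (h (t + s)) by ring.
    rewrite !Hfh; ring. }
  assert (Hu0 : u <> 0).
  { intros Hu; rewrite Hu, Rplus_0_r in Hfu; lra. }
  assert (Hq : e <= s / u).
  { destruct (Rtotal_order u 0) as [H | [H | H]]; [ | lra | ].
    - pose proof (Hgrow (h t + u) (h t) ltac:(lra)) as H1.
      replace (s / u) with ((- s) / (- u)) by (field; lra).
      apply Rle_div_r; lra.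
    - pose proof (Hgrow (h t) (h t + u) ltac:(lra)) as H1.
      apply Rle_div_r; lra. }
  assert (Hud : Rabs u < d).
  { apply (Rmult_lt_reg_l e); [exact He | ].
    apply Rle_lt_trans with (2 := Hsd).
    replace s with (s / u * u) by (field; exact Hu0).
    rewrite Rabs_mult; apply Rmult_le_compat_r; [apply Rabs_pos | ].
    apply Rle_trans with (1 := Hq), Rle_abs. }
  specialize (Hd u Hu0 Hud); rewrite Hfu in Hd; fold l in Hd.
  replace (u / s - / l) with (- ((s / u - l) * / (l * (s / u)))) by (field; lra).
  assert (Hpos : e * e <= l * (s / u)) by (apply Rmult_le_compat; lra).
  assert (Hee : 0 < e * e) by (apply Rmult_lt_0_compat; exact He).
  rewrite Rabs_Ropp, Rabs_mult, Rabs_inv.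
  rewrite (Rabs_pos_eq (l * (s / u))) by lra.
  apply Rlt_div_l; [lra | ].
  apply Rlt_le_trans with (1 := Hd).
  apply Rmult_le_compat_l; lra.
Qed.

(** Both signs occur: the angle increases for [lambda > 1] and decreases for [lambda < -1]. A
    decreasing [f] is handled by inverting [- f] and precomposing with negation. *)
Lemma inverse_of_derive_away_from_0 (f g : R -> R) (e : R) :
  0 < e -> (forall t, is_derive f t (g t)) ->
  (forall t, e <= g t) \/ (forall t, e <= - g t) ->
  exists h : R -> R,
    (forall t, f (h t) = t) /\ (forall y, h (f y) = y) /\
    (forall t, is_derive h t (/ g (h t))).
Proof.
  intros He Hf [Hg | Hg].
  { exact (inverse_of_derive_ge f g e He Hf Hg). }
  destruct (inverse_of_derive_ge (fun y => - f y) (fun y => - g y) e He)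
    as [h [H1 [H2 H3]]].
  { intros t; apply (is_derive_opp f t (g t)), Hf. }
  { exact Hg. }
  exists (fun t => h (- t)); split; [ | split].
  - intros t; pose proof (H1 (- t)); lra.
  - exact H2.
  - intros t.
    replace (/ g (h (- t))) with (scal (-1) (/ (- g (h (- t))))).
    + apply (is_derive_comp h (fun s => - s)); [apply H3 | ].
      auto_derive; [exact I | ring].
    + unfold scal; simpl; unfold mult; simpl.
      field. pose proof (Hg (h (- t))); lra.
Qed.

(* Gronwall without the exponential bound: [f exp (K t)] is nondecreasing and
   [f exp (- K t)] nonincreasing. *)
Lemma vanishes_everywhere_of_derive_bound (f df : R -> R) (K : R) :
  (forall t, 0 <= f t) -> (forall t, is_derive f t (df t)) ->
  (forall t, Rabs (df t) <= K * f t) ->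
  forall s, f s = 0 -> forall t, f t = 0.
Proof.
  intros Hpos Hf Hb s Hs t.
  assert (Hd : forall c y, is_derive (fun y => f y * exp (c * y)) y
                             ((df y + c * f y) * exp (c * y))).
  { intros c y; pose proof (Hf y).
    auto_derive; [exists (df y); assumption | ].
    replace (Derive (fun x => f x) y) with (df y)
      by (symmetry; apply is_derive_unique; exact H).
    ring. }
  assert (Hz : forall c y, f y * exp (c * y) <= 0 -> f y = 0).
  { intros c y Hy; pose proof (exp_pos (c * y)); pose proof (Hpos y); nra. }
  destruct (Rle_dec s t) as [Hst | Hst].
  - apply (Hz (- K) t).
    pose proof (derive_ge_increment (fun y => - (f y * exp (- K * y)))
      (fun y => - ((df y + - K * f y) * exp (- K * y))) 0) as H.
    assert (H' : 0 * (t - s) <= - (f t * exp (- K * t)) - - (f s * exp (- K * s))).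
    { apply H; [ | | exact Hst].
      - intros y; apply (is_derive_opp (fun y => f y * exp (- K * y))), Hd.
      - intros y; pose proof (exp_pos (- K * y)).
        pose proof (Rle_abs (df y)); pose proof (Hb y); nra. }
    rewrite Hs in H'; lra.
  - apply (Hz K t).
    assert (H' : 0 * (s - t) <= f s * exp (K * s) - f t * exp (K * t)).
    { apply (derive_ge_increment (fun y => f y * exp (K * y))
               (fun y => (df y + K * f y) * exp (K * y)) 0); [apply Hd | | lra].
      intros y; pose proof (exp_pos (K * y)).
      pose proof (Rle_abs (- df y)) as Ha; rewrite Rabs_Ropp in Ha.
      pose proof (Hb y); nra. }
    rewrite Hs in H'; lra.
Qed.

(** * Identified states and the vector field on [V = 1] *)

Lemma same_state_sym (p q : state) : same_state p q -> same_state q p.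
Proof.
  intros (Hx & Hr & Ht); split; [ | split]; [now symmetry.. | ].
  destruct Ht as [Ht | [k Ht]]; [left; lra | right].
  exists (- k)%Z; rewrite opp_IZR, Ht; ring.
Qed.

Lemma same_state_trans (p q r : state) :
  same_state p q -> same_state q r -> same_state p r.
Proof.
  intros (Hx & Hr & Ht) (Hx' & Hr' & Ht'); split; [ | split]; [lra.. | ].
  destruct Ht as [Ht | [k Ht]]; [left; lra | ].
  destruct Ht' as [Ht' | [k' Ht']]; [left; lra | right].
  exists (k + k')%Z; rewrite plus_IZR, Ht, Ht'; ring.
Qed.

Definition kappa (S : R) : R := 2 * sqrt 3 * Nstar S.

Lemma kappa_pos (S : R) : -1 < S < 0 -> 0 < kappa S.
Proof.
  intros HS; unfold kappa, Nstar.
  assert (0 < sqrt 3) by (apply sqrt_lt_R0; lra).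
  assert (0 < sqrt (- S * (1 + S))) by (apply sqrt_lt_R0; nra).
  nra.
Qed.

Lemma V1_sphere (p : state) : V p = 1 -> x p ^ 2 + rho p = 1.
Proof.
  unfold V; intros H.
  destruct (Rle_dec 0 (x p ^ 2 + rho p)) as [Hp | Hp].
  - rewrite <- (sqrt_sqrt _ Hp), H; ring.
  (* [sqrt] takes the value 0 on negative numbers, which contradicts [V p = 1]. *)
  - rewrite sqrt_neg_0 in H; lra.
Qed.

(** The term with [1 - V^2] vanishes and the denominator becomes [2 - gamma], which cancels: on the
    sphere the dynamics does not depend on [gamma]. *)
Lemma T_V1 (gamma S : R) (p : state) :
  gamma < 2 -> V p = 1 -> T gamma S p = V2S S p.
Proof. intros Hg HV; unfold T; rewrite HV; field; lra. Qed.

(** Substituting [rho = 1 - x^2] makes the factor [rho] appear, so the poles are rest points. *)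
Lemma x_rhs_V1 (gamma S : R) (p : state) :
  gamma < 2 -> V p = 1 ->
  x_rhs gamma S p =
  rho p * (3 * S * x p - (1 + S)
           - kappa S / 2 * (1 - x p) * cos (theta p)).
Proof.
  intros Hg HV; unfold x_rhs; rewrite (T_V1 _ _ _ Hg HV).
  unfold V2S, Astar, kappa.
  replace (rho p) with (1 - x p ^ 2) by (pose proof (V1_sphere p HV); lra).
  field.
Qed.

(** This is [- 2 x] times the [x]-component: the field is tangent to the sphere [x^2 + rho = 1]. *)
Lemma rho_rhs_V1 (gamma S : R) (p : state) :
  gamma < 2 -> V p = 1 ->
  rho_rhs gamma S p =
  - (2 * x p * rho p * (3 * S * x p - (1 + S)
                        - kappa S / 2 * (1 - x p) * cos (theta p))).
Proof.
  intros Hg HV; unfold rho_rhs; rewrite (T_V1 _ _ _ Hg HV).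
  unfold V2S, Astar, kappa, alpha.
  replace (rho p) with (1 - x p ^ 2) by (pose proof (V1_sphere p HV); lra).
  field.
Qed.

Lemma theta_rhs_kappa (S l : R) (p : state) :
  theta_rhs S l p = kappa S * (1 - x p) * (l + sin (theta p)).
Proof. unfold theta_rhs, alpha, kappa; ring. Qed.

(** * The periodic solution of the linear equation and the closed curve it defines *)

(* The 2 pi-periodic solution of
   [k (l + sin th) w' = (k cos th - m) w + b]. *)
Definition cycle_w (m b k l th : R) : R :=
  b / (m * (m ^ 2 + k ^ 2 * (l ^ 2 - 1)))
  * (m ^ 2 + l ^ 2 * k ^ 2 + l * k ^ 2 * sin th + m * k * cos th).

Lemma cycle_w_denom_pos (m k l : R) :
  0 < m -> 0 < k -> 1 < l ^ 2 -> 0 < m ^ 2 + k ^ 2 * (l ^ 2 - 1).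
Proof.
  intros Hm Hk Hl; assert (0 < k ^ 2 * (l ^ 2 - 1)) by (apply Rmult_lt_0_compat; nra).
  nra.
Qed.

(* Cauchy-Schwarz: the trigonometric factor is [|v|^2 + k v.(sin, cos)] with
   [v = (l k, m)] and [|v| > k]. *)
Lemma cycle_w_pos (m b k l th : R) :
  0 < m -> 0 < b -> 0 < k -> 1 < l ^ 2 -> 0 < cycle_w m b k l th.
Proof.
  intros Hm Hb Hk Hl; pose proof (cycle_w_denom_pos m k l Hm Hk Hl) as HD.
  unfold cycle_w; apply Rmult_lt_0_compat.
  { apply Rdiv_lt_0_compat; [exact Hb | apply Rmult_lt_0_compat; assumption]. }
  pose proof (sin2_cos2 th) as Hsc; unfold Rsqr in Hsc.
  set (s := sin th) in *; set (c := cos th) in *.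
  assert (E : 2 * (m ^ 2 + l ^ 2 * k ^ 2 + l * k ^ 2 * s + m * k * c)
              = (l * k + k * s) ^ 2 + (m + k * c) ^ 2
                + (m ^ 2 + k ^ 2 * (l ^ 2 - 1))
                + k ^ 2 * (1 - (s * s + c * c))) by ring.
  rewrite Hsc in E.
  pose proof (pow2_ge_0 (l * k + k * s)); pose proof (pow2_ge_0 (m + k * c)).
  lra.
Qed.

(** The sign gives the sense of rotation; the upper bound will limit the angular speed. *)
Lemma l_plus_sin_away_from_0 (l : R) :
  1 < l ^ 2 ->
  (forall th, 0 < l + sin th <= Rabs l + 1) \/
  (forall th, 0 < - (l + sin th) <= Rabs l + 1).
Proof.
  intros Hl; destruct (Rlt_dec l 0) as [H | H]; [right | left]; intros th;
    pose proof (SIN_bound th); [rewrite Rabs_left | rewrite Rabs_right]; nra.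
Qed.

Lemma l_plus_sin_neq_0 (l th : R) : 1 < l ^ 2 -> l + sin th <> 0.
Proof.
  intros Hl; destruct (l_plus_sin_away_from_0 l Hl) as [H | H];
    specialize (H th); lra.
Qed.

Lemma cycle_w_ode (m b k l th : R) :
  0 < m -> 0 < k -> 1 < l ^ 2 ->
  is_derive (cycle_w m b k l) th
    (((k * cos th - m) * cycle_w m b k l th + b) / (k * (l + sin th))).
Proof.
  intros Hm Hk Hl; pose proof (cycle_w_denom_pos m k l Hm Hk Hl) as HD.
  pose proof (l_plus_sin_neq_0 l th Hl).
  unfold cycle_w; auto_derive; [exact I | ].
  pose proof (sin2_cos2 th) as Hsc; unfold Rsqr in Hsc.
  set (s := sin th) in *; set (c := cos th) in *.
  set (D := m ^ 2 + k ^ 2 * (l ^ 2 - 1)) in *.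
  (* Modulo [sin^2 + cos^2 = 1], the trigonometric factor of [cycle_w] solves the equation with
     constant term [m * D]; the prefactor [b / (m * D)] rescales this term to [b]. *)
  assert (E : (l * k ^ 2 * c - m * k * s) * (k * (l + s))
              = (k * c - m) * (m ^ 2 + l ^ 2 * k ^ 2 + l * k ^ 2 * s + m * k * c)
                + m * D).
  { apply Rminus_diag_uniq; unfold D.
    transitivity (m * k ^ 2 * (1 - (s * s + c * c))); [ring | rewrite Hsc; ring]. }
  set (Y := m ^ 2 + l ^ 2 * k ^ 2 + l * k ^ 2 * s + m * k * c) in *.
  replace (m * (m * 1) + k * (k * 1) * (l * (l * 1) - 1)) with D by (unfold D; ring).
  transitivity (b / (m * D) * ((l * k ^ 2 * c - m * k * s) * (k * (l + s)))
                / (k * (l + s))); [field | rewrite E; field]; lra.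
Qed.

Lemma sin_cos_period_Z (th : R) (n : Z) :
  sin (th + 2 * PI * IZR n) = sin th /\ cos (th + 2 * PI * IZR n) = cos th.
Proof.
  assert (Hn : forall y j, sin (y + 2 * PI * INR j) = sin y
                           /\ cos (y + 2 * PI * INR j) = cos y).
  { intros y j; replace (y + 2 * PI * INR j) with (y + 2 * INR j * PI) by ring.
    split; [apply sin_period | apply cos_period]. }
  destruct (Z_le_gt_dec 0 n) as [H | H].
  - rewrite <- (Z2Nat.id n H), <- INR_IZR_INZ; apply Hn.
  - destruct (Hn (th + 2 * PI * IZR n) (Z.to_nat (- n))) as [H1 H2].
    rewrite INR_IZR_INZ, Z2Nat.id, opp_IZR in H1, H2 by lia.
    replace (th + 2 * PI * IZR n + 2 * PI * - IZR n) with th in H1, H2 by ring.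
    split; symmetry; assumption.
Qed.

Lemma cycle_w_period (m b k l th : R) (n : Z) :
  cycle_w m b k l (th + 2 * PI * IZR n) = cycle_w m b k l th.
Proof.
  unfold cycle_w; destruct (sin_cos_period_Z th n) as [-> ->]; reflexivity.
Qed.

(* [x] in terms of [w = (1 - x) / (2 (1 + x))]. *)
Definition cycle_x (S l th : R) : R :=
  let w := cycle_w (- (1 + 4 * S)) (1 / 2 - S) (kappa S) l th in
  (1 - 2 * w) / (1 + 2 * w).

(** The angular velocity along the curve. It depends on the angle alone, so [theta] obeys an
    autonomous scalar equation there. *)
Definition cycle_speed (S l th : R) : R :=
  kappa S * (1 - cycle_x S l th) * (l + sin th).

(** The Möbius map from [w] to [x] sends positive numbers into (-1, 1), so positivity of [cycle_w]
    keeps the curve away from the poles. *)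
Lemma cycle_x_bounds (S l th : R) :
  -1 < S < - (1 / 4) -> 1 < l ^ 2 -> -1 < cycle_x S l th < 1.
Proof.
  intros HS Hl; unfold cycle_x; cbv zeta.
  pose proof (kappa_pos S ltac:(lra)) as Hk.
  pose proof (cycle_w_pos (- (1 + 4 * S)) (1 / 2 - S) (kappa S) l th
                ltac:(lra) ltac:(lra) Hk Hl) as Hw.
  set (w := cycle_w _ _ _ _ _) in *.
  split; [apply Rlt_div_r | apply Rlt_div_l]; lra.
Qed.

Lemma cycle_speed_neq_0 (S l th : R) :
  -1 < S < - (1 / 4) -> 1 < l ^ 2 -> cycle_speed S l th <> 0.
Proof.
  intros HS Hl; unfold cycle_speed.
  pose proof (kappa_pos S ltac:(lra)).
  pose proof (cycle_x_bounds S l th HS Hl).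
  pose proof (l_plus_sin_neq_0 l th Hl).
  apply Rmult_integral_contrapositive_currified; [ | assumption];
    apply Rmult_integral_contrapositive_currified; lra.
Qed.

(** The slope is [x' / theta'] on the sphere, which makes the curve invariant. It follows by
    inserting the linear equation for [w] into the Möbius map. *)
Lemma cycle_x_ode (S l th : R) :
  -1 < S < - (1 / 4) -> 1 < l ^ 2 ->
  is_derive (cycle_x S l) th
    ((1 - cycle_x S l th ^ 2)
     * (3 * S * cycle_x S l th - (1 + S)
        - kappa S / 2 * (1 - cycle_x S l th) * cos th)
     / cycle_speed S l th).
Proof.
  intros HS Hl.
  pose proof (kappa_pos S ltac:(lra)) as Hk.
  pose proof (l_plus_sin_neq_0 l th Hl) as Hls.
  pose proof (cycle_w_pos (- (1 + 4 * S)) (1 / 2 - S) (kappa S) l th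
                ltac:(lra) ltac:(lra) Hk Hl) as Hw.
  pose proof (cycle_w_ode (- (1 + 4 * S)) (1 / 2 - S) (kappa S) l th
                ltac:(lra) Hk Hl) as Hd.
  unfold cycle_speed, cycle_x; cbv zeta.
  set (W := cycle_w (- (1 + 4 * S)) (1 / 2 - S) (kappa S) l) in *.
  auto_derive.
  - repeat split; try lra; eexists; exact Hd.
  - replace (Derive (fun x => W x) th) with
      (((kappa S * cos th - - (1 + 4 * S)) * W th + (1 / 2 - S))
       / (kappa S * (l + sin th)))
      by (symmetry; apply is_derive_unique; exact Hd).
    field; repeat split; lra.
Qed.

Lemma cycle_x_period (S l th : R) (n : Z) :
  cycle_x S l (th + 2 * PI * IZR n) = cycle_x S l th.
Proof. unfold cycle_x; rewrite cycle_w_period; reflexivity. Qed.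

Lemma cycle_speed_period (S l th : R) (n : Z) :
  cycle_speed S l (th + 2 * PI * IZR n) = cycle_speed S l th.
Proof.
  unfold cycle_speed; rewrite cycle_x_period.
  destruct (sin_cos_period_Z th n) as [-> _]; reflexivity.
Qed.

Lemma cycle_speed_continuous (S l th : R) :
  -1 < S < - (1 / 4) -> 1 < l ^ 2 -> continuous (cycle_speed S l) th.
Proof.
  intros HS Hl; apply (ex_derive_continuous (cycle_speed S l)).
  unfold cycle_speed; auto_derive.
  eexists; exact (cycle_x_ode S l th HS Hl).
Qed.

(** * Every closed orbit avoids the poles and lies on the curve *)

(** Since [|rho'| <= K rho], an orbit that meets a pole has [rho = 0] forever. Then [x' = 0] as
    well, so the orbit is an equilibrium, which is excluded. *)
Lemma closed_orbit_rho_pos (gamma S l P : R) (c : R -> state) :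
  -1 < S < - (1 / 4) -> gamma < 2 ->
  closed_periodic_orbit_V1 gamma S l c P -> forall t, 0 < rho (c t).
Proof.
  intros HS Hg [(Hsol & HP & Hper & Hne) HV] t.
  pose proof (kappa_pos S ltac:(lra)) as Hk.
  destruct (proj1 (proj1 (Hsol t))) as [H | H]; [exact H | exfalso].
  assert (Hr0 : forall s, rho (c s) = 0).
  { apply (vanishes_everywhere_of_derive_bound (fun s => rho (c s))
             (fun s => rho_rhs gamma S (c s)) (2 * (4 + kappa S))) with (s := t).
    - intros s; apply (Hsol s).
    - intros s; apply (Hsol s).
    - intros s; rewrite (rho_rhs_V1 _ _ _ Hg (HV s)).
      pose proof (V1_sphere _ (HV s)) as Hsph.
      pose proof (proj1 (proj1 (Hsol s))) as Hrho.
      set (X := x (c s)) in *; set (r := rho (c s)) in *.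
      assert (HX : -1 <= X <= 1) by nra.
      pose proof (COS_bound (theta (c s))) as Hc.
      set (C := cos (theta (c s))) in *.
      assert (HXC : Rabs ((1 - X) * C) <= 2).
      { rewrite Rabs_mult.
        replace 2 with (2 * 1) by ring.
        apply Rmult_le_compat; try apply Rabs_pos; apply Rabs_le; lra. }
      apply Rabs_le_between in HXC.
      assert (HSX : -3 <= 3 * S * X <= 3) by nra.
      assert (Hkc : - kappa S <= kappa S / 2 * (1 - X) * C <= kappa S) by nra.
      rewrite Rabs_Ropp, !Rabs_mult, (Rabs_pos_eq r Hrho), (Rabs_pos_eq 2) by lra.
      rewrite !Rmult_assoc; apply Rmult_le_compat_l; [lra | ].
      rewrite <- (Rmult_1_l ((4 + kappa S) * r)).
      apply Rmult_le_compat; [apply Rabs_pos | | apply Rabs_le; lra | ].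
      + apply Rmult_le_pos; [exact Hrho | apply Rabs_pos].
      + rewrite Rmult_comm; apply Rmult_le_compat_r; [exact Hrho | ].
        apply Rabs_le; rewrite <- !Rmult_assoc; lra.
    - symmetry; exact H. }
  apply Hne; intros s; split; [ | split; [ | left]];
    [ | rewrite !Hr0; reflexivity | apply Hr0].
  apply (derive_zero_const (fun u => x (c u))); intros u.
  destruct (Hsol u) as (_ & Hx & _).
  rewrite (x_rhs_V1 _ _ _ Hg (HV u)), Hr0, Rmult_0_l in Hx; exact Hx.
Qed.

(* On [V = 1] the coordinate [(1 - x) / (2 (1 + x))] turns the equation for
   [x], which is a Riccati equation in the time [theta], into a linear one. *)
Lemma is_derive_stereographic (X : R -> R) (t dX : R) :
  is_derive X t dX -> 1 + X t <> 0 ->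
  is_derive (fun s => (1 - X s) / (2 * (1 + X s))) t (- dX / (1 + X t) ^ 2).
Proof.
  intros HX Hne; auto_derive.
  - repeat split; try (exists dX; exact HX); lra.
  - replace (Derive (fun s => X s) t) with dX
      by (symmetry; apply is_derive_unique; exact HX).
    field; exact Hne.
Qed.

(* Two solutions of [w' = a ((k cos th - m) w + b)] along
   [th' = a k (l + sin th)] differ by a multiple of [l + sin th] which decays
   at rate [m a]. *)
Lemma ratio_decay (k l m b a t Tt : R) (w z th : R -> R) :
  1 < l ^ 2 -> th t = Tt ->
  is_derive w t (a * ((k * cos Tt - m) * w t + b)) ->
  is_derive z t (a * ((k * cos Tt - m) * z t + b)) ->
  is_derive th t (a * k * (l + sin Tt)) ->
  is_derive (fun s => (w s - z s) / (l + sin (th s))) t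
    (- m * a * ((w t - z t) / (l + sin (th t)))).
Proof.
  intros Hl <- Hw Hz Hth.
  pose proof (l_plus_sin_neq_0 l (th t) Hl).
  auto_derive.
  - repeat split; try (eexists; eassumption); assumption.
  - replace (Derive (fun x => w x) t) with (a * ((k * cos (th t) - m) * w t + b))
      by (symmetry; apply is_derive_unique; exact Hw).
    replace (Derive (fun x => z x) t) with (a * ((k * cos (th t) - m) * z t + b))
      by (symmetry; apply is_derive_unique; exact Hz).
    replace (Derive (fun x => th x) t) with (a * k * (l + sin (th t)))
      by (symmetry; apply is_derive_unique; exact Hth).
    field; assumption.
Qed.

Lemma closed_orbit_on_cycle (gamma S l P : R) (c : R -> state) :
  -1 < S < - (1 / 4) -> 1 < l ^ 2 -> gamma < 2 ->
  closed_periodic_orbit_V1 gamma S l c P ->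
  forall t, x (c t) = cycle_x S l (theta (c t)).
Proof.
  intros HS Hl Hg Hc.
  pose proof (closed_orbit_rho_pos gamma S l P c HS Hg Hc) as Hrho.
  destruct Hc as [(Hsol & HP & Hper & _) HV].
  pose proof (kappa_pos S ltac:(lra)) as Hk.
  set (m := - (1 + 4 * S)); set (b := 1 / 2 - S); set (k := kappa S) in *.
  assert (Hx1 : forall t, -1 < x (c t) < 1).
  { intros t; pose proof (V1_sphere _ (HV t)); pose proof (Hrho t); nra. }
  set (w := fun t => (1 - x (c t)) / (2 * (1 + x (c t)))).
  set (z := fun t => cycle_w m b k l (theta (c t))).
  set (d := fun t => (w t - z t) / (l + sin (theta (c t)))).
  assert (Hd : forall t, is_derive d t (- m * (1 - x (c t)) * d t)).
  { intros t; destruct (Hsol t) as (_ & Hdx & _ & Hdth).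
    specialize (Hdth (Hrho t)).
    rewrite theta_rhs_kappa in Hdth; fold k in Hdth.
    rewrite (x_rhs_V1 _ _ _ Hg (HV t)) in Hdx; fold k in Hdx.
    pose proof (V1_sphere _ (HV t)) as Hsph.
    replace (rho (c t)) with (1 - x (c t) ^ 2) in Hdx by lra.
    pose proof (Hx1 t) as Hxt.
    pose proof (l_plus_sin_neq_0 l (theta (c t)) Hl).
    apply (ratio_decay k l m b (1 - x (c t)) t (theta (c t)) w z
             (fun s => theta (c s)) Hl eq_refl).
    (* This identity is where the Riccati equation for [x] turns into the linear one for [w]. *)
    - replace ((1 - x (c t)) * _) with
        (- ((1 - x (c t) ^ 2) * (3 * S * x (c t) - (1 + S)
             - k / 2 * (1 - x (c t)) * cos (theta (c t)))) / (1 + x (c t)) ^ 2)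
        by (unfold w, m, b; field; lra).
      apply (is_derive_stereographic (fun s => x (c s))); [exact Hdx | lra].
    - unfold z.
      replace ((1 - x (c t)) * _) with
        (scal (k * (1 - x (c t)) * (l + sin (theta (c t))))
           (((k * cos (theta (c t)) - m) * cycle_w m b k l (theta (c t)) + b)
            / (k * (l + sin (theta (c t))))))
        by (unfold scal; simpl; unfold mult; simpl; field; lra).
      apply (is_derive_comp (cycle_w m b k l) (fun s => theta (c s)));
        [apply cycle_w_ode; unfold m; lra | exact Hdth].
    - replace ((1 - x (c t)) * k * (l + sin (theta (c t))))
        with (k * (1 - x (c t)) * (l + sin (theta (c t)))) by ring.
      exact Hdth. }
  assert (Hdper : forall t, d (t + P) = d t).
  { intros t; destruct (Hper t) as (Hx & Hr & Hth).
    destruct Hth as [Hth | [n Hth]]; [pose proof (Hrho (t + P)); lra | ].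
    unfold d, w, z; rewrite Hx, Hth, cycle_w_period.
    destruct (sin_cos_period_Z (theta (c t)) n) as [-> _]; reflexivity. }
  assert (Hd2 : forall t, is_derive (fun s => - (d s * d s)) t
                            (2 * m * (1 - x (c t)) * (d t * d t))).
  { intros t; pose proof (Hd t) as H.
    auto_derive; [repeat split; eexists; exact H | ].
    replace (Derive (fun s => d s) t) with (- m * (1 - x (c t)) * d t)
      by (symmetry; apply is_derive_unique; exact H).
    ring. }
  assert (Hd0 : forall t, d t = 0).
  { intros t.
    (* As [d] takes the same value at [t] and [t + P], the derivative of [- d^2] vanishes at some
       [s] in between, which forces [d s = 0]. As [- d^2] is nondecreasing, [d] vanishes at [t + P]
       too, hence at [t]. *)
    destruct (MVT_cor2 (fun s => - (d s * d s))
                (fun s => 2 * m * (1 - x (c s)) * (d s * d s)) t (t + P))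
      as [s [Hs Hst]]; [lra | intros; apply is_derive_Reals, Hd2 | ].
    rewrite Hdper in Hs.
    pose proof (Hx1 s) as Hxs.
    assert (Hds : d s * d s = 0).
    { replace (- (d t * d t) - - (d t * d t)) with 0 in Hs by ring.
      assert (Hm : 0 < 2 * m * (1 - x (c s)))
        by (apply Rmult_lt_0_compat; unfold m; lra).
      symmetry in Hs; apply Rmult_integral in Hs.
      destruct Hs as [Hs | Hs]; [ | lra].
      apply Rmult_integral in Hs; destruct Hs as [Hs | Hs]; [lra | exact Hs]. }
    assert (Hmono : 0 * (t + P - s) <= - (d (t + P) * d (t + P)) - - (d s * d s)).
    { apply (derive_ge_increment (fun s => - (d s * d s)) _ 0 Hd2); [ | lra].
      intros u; pose proof (Hx1 u).
      apply Rmult_le_pos; [ | nra].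
      apply Rmult_le_pos; unfold m; lra. }
    rewrite Hdper, Hds in Hmono.
    nra. }
  intros t; pose proof (Hx1 t) as Hxt.
  assert (Hwz : w t = z t).
  { pose proof (Hd0 t) as H; unfold d in H.
    apply Rmult_integral in H; destruct H as [H | H]; [lra | ].
    exfalso; revert H; apply Rinv_neq_0_compat, l_plus_sin_neq_0, Hl. }
  unfold cycle_x; cbv zeta; fold m b k.
  change (cycle_w m b k l (theta (c t))) with (z t); rewrite <- Hwz.
  unfold w; field; repeat split; lra.
Qed.

(** * Time along the curve as a function of the angle *)

(* [f] is the time along the closed curve as a function of the angle, [h] its
   inverse, and [Q] the time (of the sign of [l]) of one turn. *)
Definition cycle_clock (S l : R) (f h : R -> R) (Q : R) : Prop :=
  (forall th, is_derive f th (/ cycle_speed S l th)) /\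
  (forall t, is_derive h t (cycle_speed S l (h t))) /\
  (forall t, f (h t) = t) /\ (forall th, h (f th) = th) /\
  (forall th (n : Z), f (th + 2 * PI * IZR n) = f th + IZR n * Q).

(** Separation of variables: [f] integrates the reciprocal of the speed. The speed is bounded, so
    the slope of [f] stays away from 0 and [f] has a global inverse. *)
Lemma cycle_clock_exists (S l : R) :
  -1 < S < - (1 / 4) -> 1 < l ^ 2 -> exists f h Q, cycle_clock S l f h Q.
Proof.
  intros HS Hl.
  pose proof (kappa_pos S ltac:(lra)) as Hk.
  set (g := fun th => / cycle_speed S l th).
  assert (Hg : forall th, continuous g th).
  { intros th; apply continuous_Rinv_comp;
      [apply cycle_speed_continuous | apply cycle_speed_neq_0]; assumption. }
  pose (f := (fun th => RInt g 0 th) : R -> R).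
  assert (Hf : forall th, is_derive f th (g th)).
  { intros th; apply (is_derive_RInt g f 0 th); [ | apply Hg].
    apply filter_forall; intros y; apply (RInt_correct (V := R_CompleteNormedModule) g 0 y).
    apply (ex_RInt_continuous (V := R_CompleteNormedModule)); intros; apply Hg. }
  (* A bound for the absolute speed, from [1 - x < 2] and [|l + sin th| <= |l| + 1]. *)
  set (B := kappa S * 2 * (Rabs l + 1)).
  assert (HB : 0 < B).
  { pose proof (Rabs_pos l); unfold B; nra. }
  assert (Hbd : forall th u, u <= Rabs l + 1 -> 0 < u ->
            / B <= / (kappa S * (1 - cycle_x S l th) * u)).
  { intros th u Hu Hu0; pose proof (cycle_x_bounds S l th HS Hl).
    apply Rinv_le_contravar.
    - apply Rmult_lt_0_compat; [apply Rmult_lt_0_compat | ]; lra.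
    - apply Rmult_le_compat; [ | lra | | lra].
      + apply Rmult_le_pos; lra.
      + apply Rmult_le_compat_l; lra. }
  destruct (inverse_of_derive_away_from_0 f g (/ B)) as (h & H1 & H2 & H3).
  - apply Rinv_0_lt_compat, HB.
  - exact Hf.
  - destruct (l_plus_sin_away_from_0 l Hl) as [H | H]; [left | right];
      intros th; destruct (H th) as [Hpos Hle].
    + apply Hbd; assumption.
    + unfold g; rewrite <- Rinv_opp; unfold cycle_speed.
      rewrite Ropp_mult_distr_r; apply Hbd; assumption.
  (* By periodicity of the speed, the difference of [f] at two angles a fixed number of turns apart
     has derivative 0. *)
  - assert (Hshift : forall n th, f (th + 2 * PI * IZR n) - f th
                                  = f (2 * PI * IZR n) - f 0).
    { intros n th.
      rewrite <- (Rplus_0_l (2 * PI * IZR n)) at 2.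
      apply (derive_zero_const (fun y => f (y + 2 * PI * IZR n) - f y)).
      intros y.
      replace 0 with (minus (scal 1 (g (y + 2 * PI * IZR n))) (g y)).
      - apply (is_derive_minus (fun y => f (y + 2 * PI * IZR n)) f); [ | apply Hf].
        apply (is_derive_comp f (fun y => y + 2 * PI * IZR n)); [apply Hf | ].
        auto_derive; [exact I | ring].
      - unfold g; rewrite cycle_speed_period.
        unfold minus, plus, opp, scal; simpl; unfold mult; simpl; ring. }
    set (Q := f (2 * PI) - f 0).
    assert (Hstep : forall th, f (th + 2 * PI) = f th + Q).
    { intros th; pose proof (Hshift 1%Z th) as H; rewrite Rmult_1_r in H.
      unfold Q; lra. }
    assert (Hnat : forall (n : nat) th,
               f (th + 2 * PI * INR n) = f th + INR n * Q).
    { induction n as [ | n IH]; intros th.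
      - simpl; rewrite Rmult_0_r, Rplus_0_r; ring.
      - rewrite S_INR.
        replace (th + 2 * PI * (INR n + 1)) with (th + 2 * PI * INR n + 2 * PI)
          by ring.
        rewrite Hstep, IH; ring. }
    exists f, h, Q.
    refine (conj Hf (conj _ (conj H1 (conj H2 _)))).
    + intros t; rewrite <- (Rinv_inv (cycle_speed S l (h t))); apply H3.
    + intros th n; destruct (Z_le_gt_dec 0 n) as [H | H].
      * rewrite <- (Z2Nat.id n H), <- INR_IZR_INZ; apply Hnat.
      * pose proof (Hnat (Z.to_nat (- n)) (th + 2 * PI * IZR n)) as Hn.
        rewrite INR_IZR_INZ, Z2Nat.id, opp_IZR in Hn by lia.
        replace (th + 2 * PI * IZR n + 2 * PI * - IZR n) with th in Hn by ring.
        lra.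
Qed.

(** * Existence: the curve carries a closed periodic orbit *)

Definition cycle_orbit (S l : R) (h : R -> R) (t : R) : state :=
  State (cycle_x S l (h t)) (1 - cycle_x S l (h t) ^ 2) (h t).

Lemma cycle_clock_step (S l : R) (f h : R -> R) (Q t : R) (n : Z) :
  cycle_clock S l f h Q -> h (t + IZR n * Q) = h t + 2 * PI * IZR n.
Proof.
  intros (_ & _ & Hfh & Hhf & HQ).
  rewrite <- (Hhf (h t + _)), HQ, Hfh; reflexivity.
Qed.

Lemma cycle_orbit_period (S l : R) (f h : R -> R) (Q t : R) (n : Z) :
  cycle_clock S l f h Q ->
  same_state (cycle_orbit S l h (t + IZR n * Q)) (cycle_orbit S l h t).
Proof.
  intros Hf; unfold cycle_orbit.
  rewrite (cycle_clock_step S l f h Q t n Hf), cycle_x_period.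
  split; [reflexivity | split; [reflexivity | right]].
  exists n; reflexivity.
Qed.

Lemma cycle_clock_period_neq_0 (S l : R) (f h : R -> R) (Q : R) :
  cycle_clock S l f h Q -> Q <> 0.
Proof.
  intros Hf HQ; pose proof (cycle_clock_step S l f h Q 0 1%Z Hf) as H.
  rewrite HQ, Rmult_0_r, Rplus_0_r in H; pose proof PI_RGT_0; lra.
Qed.

(** [Q] may be negative while a period must be positive; writing [|Q|] as an integer multiple of [Q]
    lets the statements about [n] turns apply to it. *)
Lemma Rabs_eq_IZR_mult (Q : R) : exists e : Z, Rabs Q = IZR e * Q.
Proof.
  destruct (Rle_dec 0 Q).
  - exists 1%Z; rewrite Rabs_pos_eq by assumption; ring.
  - exists (-1)%Z; rewrite Rabs_left by lra; ring.
Qed.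

Lemma cycle_orbit_closed (gamma S l : R) (f h : R -> R) (Q : R) :
  -1 < S < - (1 / 4) -> 1 < l ^ 2 -> gamma < 2 -> cycle_clock S l f h Q ->
  closed_periodic_orbit_V1 gamma S l (cycle_orbit S l h) (Rabs Q).
Proof.
  intros HS Hl Hg Hf.
  assert (HV : forall t, V (cycle_orbit S l h t) = 1).
  { intros t; unfold V, cycle_orbit; simpl x; simpl rho.
    rewrite Rplus_minus; exact sqrt_1. }
  assert (Hrho : forall t, 0 < rho (cycle_orbit S l h t)).
  { intros t; pose proof (cycle_x_bounds S l (h t) HS Hl); simpl rho; nra. }
  split; [ | exact HV].
  split; [ | split; [ | split]].
  - intros t.
    assert (Hh : is_derive h t (cycle_speed S l (h t))) by apply Hf.
    assert (Hx : is_derive (fun s => cycle_x S l (h s)) t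
                   ((1 - cycle_x S l (h t) ^ 2)
                    * (3 * S * cycle_x S l (h t) - (1 + S)
                       - kappa S / 2 * (1 - cycle_x S l (h t)) * cos (h t)))).
    { pose proof (is_derive_comp (cycle_x S l) h t _ _
                    (cycle_x_ode S l (h t) HS Hl) Hh) as H.
      eapply is_derive_ext; [reflexivity | ].
      replace (_ * _) with (scal (cycle_speed S l (h t))
        ((1 - cycle_x S l (h t) ^ 2)
         * (3 * S * cycle_x S l (h t) - (1 + S)
            - kappa S / 2 * (1 - cycle_x S l (h t)) * cos (h t))
         / cycle_speed S l (h t))); [exact H | ].
      unfold scal; simpl; unfold mult; simpl.
      field; apply cycle_speed_neq_0; assumption. }
    split; [ | split; [ | split]].
    + split; [apply Rlt_le, Hrho | rewrite HV; lra].
    + rewrite (x_rhs_V1 _ _ _ Hg (HV t)); exact Hx.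
    + rewrite (rho_rhs_V1 _ _ _ Hg (HV t)); simpl.
      set (X := fun s => cycle_x S l (h s)) in *.
      change (cycle_x S l (h t)) with (X t) in *.
      apply (is_derive_ext (fun s => 1 - X s ^ 2)); [reflexivity | ].
      auto_derive; [eexists; exact Hx | ].
      match type of Hx with is_derive _ _ ?d =>
        replace (Derive (fun s => X s) t) with d
          by (symmetry; apply is_derive_unique; exact Hx) end.
      ring.
    + intros _; rewrite theta_rhs_kappa; exact Hh.
  - apply Rabs_pos_lt, (cycle_clock_period_neq_0 S l f h Q Hf).
  - intros t; destruct (Rabs_eq_IZR_mult Q) as [e ->].
    apply (cycle_orbit_period S l f h Q t e Hf).
  - intros Hall; destruct Hf as (_ & _ & Hfh & Hhf & _).
    (* At this time the angle has advanced by half a turn, which is no multiple of [2 * PI] by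
       parity. *)
    destruct (Hall (f (h 0 + PI))) as (_ & _ & [H | [n H]]).
    { pose proof (Hrho (f (h 0 + PI))); lra. }
    unfold cycle_orbit in H; cbn [theta] in H; rewrite Hhf in H.
    assert (Hn : 1 = 2 * IZR n).
    { apply (Rmult_eq_reg_l PI); [ | apply PI_neq0]; lra. }
    rewrite <- mult_IZR in Hn; apply eq_IZR in Hn; lia.
Qed.

(** * Uniqueness: closed orbits are time shifts of one another, and traces coincide *)

(** Along the orbit [f (theta)] advances at unit rate, so the shift is its reading at time 0. The
    lifted angle is differentiable, hence the equality is exact and not merely up to
    [same_state]. *)
Lemma closed_orbit_is_cycle_orbit (gamma S l P : R) (f h : R -> R) (Q : R)
    (c : R -> state) :
  -1 < S < - (1 / 4) -> 1 < l ^ 2 -> gamma < 2 -> cycle_clock S l f h Q ->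
  closed_periodic_orbit_V1 gamma S l c P ->
  exists s, forall t, c t = cycle_orbit S l h (t + s).
Proof.
  intros HS Hl Hg (Hf & _ & _ & Hhf & _) Hc.
  pose proof (closed_orbit_rho_pos gamma S l P c HS Hg Hc) as Hrho.
  pose proof (closed_orbit_on_cycle gamma S l P c HS Hl Hg Hc) as Hx.
  destruct Hc as [(Hsol & _) HV].
  exists (f (theta (c 0))); intros t.
  assert (Hft : f (theta (c t)) - t = f (theta (c 0)) - 0).
  { apply (derive_zero_const (fun t => f (theta (c t)) - t)); intros u.
    destruct (Hsol u) as (_ & _ & _ & Hth); specialize (Hth (Hrho u)).
    rewrite theta_rhs_kappa, Hx in Hth.
    change (kappa S * _ * _) with (cycle_speed S l (theta (c u))) in Hth.
    replace 0 with (minus (scal (cycle_speed S l (theta (c u)))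
                             (/ cycle_speed S l (theta (c u)))) 1).
    - apply (is_derive_minus (fun s => f (theta (c s))) (fun s => s)).
      + apply (is_derive_comp f (fun s => theta (c s))); [apply Hf | exact Hth].
      + apply (is_derive_id (K := R_AbsRing)).
    - unfold minus, plus, opp, scal; simpl; unfold mult; simpl.
      field; apply cycle_speed_neq_0; assumption. }
  replace (t + f (theta (c 0))) with (f (theta (c t))) by lra.
  unfold cycle_orbit; rewrite Hhf, <- Hx.
  pose proof (V1_sphere _ (HV t)).
  replace (1 - x (c t) ^ 2) with (rho (c t)) by lra.
  destruct (c t); reflexivity.
Qed.

Lemma closed_orbit_traversed (gamma S l P : R) (f h : R -> R) (Q : R)
    (c : R -> state) :
  -1 < S < - (1 / 4) -> 1 < l ^ 2 -> gamma < 2 -> cycle_clock S l f h Q ->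
  closed_periodic_orbit_V1 gamma S l c P ->
  exists n, traversed (cycle_orbit S l h) (Rabs Q) n c P.
Proof.
  intros HS Hl Hg Hf Hc.
  destruct (closed_orbit_is_cycle_orbit gamma S l P f h Q c HS Hl Hg Hf Hc)
    as [s Hs].
  pose proof (closed_orbit_rho_pos gamma S l P c HS Hg Hc (0 + P)) as Hrho.
  destruct Hc as [(_ & HP & Hper & _) _].
  destruct (Hper 0) as (_ & _ & [H | [n Hn]]); [lra | ].
  (* Over time [P] the angle gains [n] full turns, each taking the signed time [Q]. *)
  assert (HPn : P = IZR n * Q).
  { destruct Hf as (_ & _ & Hfh & _ & HQ).
    rewrite !Hs in Hn; cbn in Hn; apply (f_equal f) in Hn.
    rewrite HQ, !Hfh in Hn; lra. }
  exists (Z.abs_nat n); unfold traversed.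
  assert (HPabs : P = INR (Z.abs_nat n) * Rabs Q).
  { rewrite INR_IZR_INZ, Zabs2Nat.id_abs, abs_IZR, <- Rabs_mult, <- HPn.
    symmetry; apply Rabs_pos_eq; lra. }
  split; [ | split; [exact HPabs | ]].
  - apply INR_lt; simpl; pose proof (pos_INR (Z.abs_nat n)).
    destruct (Req_dec (INR (Z.abs_nat n)) 0) as [H0 | H0]; [ | lra].
    rewrite H0 in HPabs; lra.
  - exists s; intros t; rewrite Hs.
    split; [reflexivity | split; [reflexivity | right]].
    exists 0%Z; ring.
Qed.

Lemma periodic_shifts (c : R -> state) (P : R) :
  (forall t, same_state (c (t + P)) (c t)) ->
  forall (n : Z) t, same_state (c (t + IZR n * P)) (c t).
Proof.
  intros H.
  assert (Hnat : forall (n : nat) t, same_state (c (t + INR n * P)) (c t)).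
  { induction n as [ | n IH]; intros t.
    - simpl; replace (t + 0 * P) with t by ring.
      split; [reflexivity | split; [reflexivity | right]]; exists 0%Z; ring.
    - rewrite S_INR.
      replace (t + (INR n + 1) * P) with (t + INR n * P + P) by ring.
      exact (same_state_trans _ _ _ (H _) (IH t)). }
  intros n t; destruct (Z_le_gt_dec 0 n) as [Hn | Hn].
  - rewrite <- (Z2Nat.id n Hn), <- INR_IZR_INZ; apply Hnat.
  - apply same_state_sym.
    pose proof (Hnat (Z.to_nat (- n)) (t + IZR n * P)) as E.
    rewrite INR_IZR_INZ, Z2Nat.id, opp_IZR in E by lia.
    replace (t + IZR n * P + - IZR n * P) with t in E by ring; exact E.
Qed.

(** Since [n >= 1], the interval [0, P] contains a full period of [c0], so the trace is the whole
    image of [c0], whatever [n] and the shift are. *)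
Lemma on_trace_traversed (c0 c : R -> state) (P0 P : R) (n : nat) (p : state) :
  0 < P0 -> (forall t, same_state (c0 (t + P0)) (c0 t)) ->
  traversed c0 P0 n c P ->
  on_trace c P p <-> exists t, same_state p (c0 t).
Proof.
  intros HP0 Hper (Hn & HP & s & Hs).
  split; intros [t Ht].
  - exists (t + s); exact (same_state_trans _ _ _ (proj2 Ht) (Hs t)).
  (* Removing [j] whole periods brings the time [t - s] into [0, P0). *)
  - set (j := Int_part ((t - s) / P0)).
    destruct (base_Int_part ((t - s) / P0)) as [Hj1 Hj2]; fold j in Hj1, Hj2.
    assert (E : (t - s) / P0 * P0 = t - s) by (field; lra).
    assert (H1 : 1 <= INR n) by (apply (le_INR 1); lia).
    exists (t - s + IZR (- j) * P0); split.
    + rewrite opp_IZR, HP; nra.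
    + apply same_state_trans with (1 := Ht), same_state_sym.
      apply same_state_trans with (1 := Hs _).
      replace (t - s + IZR (- j) * P0 + s) with (t + IZR (- j) * P0) by ring.
      apply periodic_shifts, Hper.
Qed.

Theorem theorem4p3 (Sigma lambda gamma : R)
    (hSigma : -1 < Sigma < - (1 / 4))
    (hlambda : 1 < lambda ^ 2)
    (hgamma : 0 < gamma < 2) :
  (exists (c : R -> state) (P : R),
      closed_periodic_orbit_V1 gamma Sigma lambda c P) /\
  (forall (c1 : R -> state) (P1 : R) (c2 : R -> state) (P2 : R),
      closed_periodic_orbit_V1 gamma Sigma lambda c1 P1 ->
      closed_periodic_orbit_V1 gamma Sigma lambda c2 P2 ->
      same_up_to_winding_number gamma Sigma lambda c1 P1 c2 P2).
Proof.
  destruct hgamma as [_ hg].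
  destruct (cycle_clock_exists Sigma lambda hSigma hlambda) as (f & h & Q & Hf).
  pose proof (cycle_orbit_closed gamma Sigma lambda f h Q hSigma hlambda hg Hf)
    as H0.
  split; [exists (cycle_orbit Sigma lambda h), (Rabs Q); exact H0 | ].
  intros c1 P1 c2 P2 Hc1 Hc2.
  destruct (closed_orbit_traversed gamma Sigma lambda P1 f h Q c1
              hSigma hlambda hg Hf Hc1) as [n1 Hn1].
  destruct (closed_orbit_traversed gamma Sigma lambda P2 f h Q c2
              hSigma hlambda hg Hf Hc2) as [n2 Hn2].
  split.
  - destruct H0 as [(_ & HP & Hper & _) _]; intros p.
    rewrite (on_trace_traversed _ _ _ _ _ p HP Hper Hn1).
    rewrite (on_trace_traversed _ _ _ _ _ p HP Hper Hn2).
    reflexivity.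
  - exists (cycle_orbit Sigma lambda h), (Rabs Q).
    split; [exact H0 | split; [exists n1 | exists n2]]; assumption.
Qed.
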